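(* Let $R$ be a ring with a nice topology. Assume that the right regular module $R_R$ has the $(C_2)$ property and that $R$ is Dedekind-finite and semi-$\pi$-regular. Then $R$ is a full exchange ring.
   Context: $R$ is Dedekind-finite if $xy=1$ implies $yx=1$. $R$ is $\pi$-regular if for each $x\in R$ there are $n\ge1$ and $y\in R$ with $x^n=x^nyx^n$; $R$ is semi-$\pi$-regular if $R/J(R)$ is $\pi$-regular and idempotents lift modulo the Jacobson radical $J(R)$. A module $M$ has $(C_2)$ if every submodule of $M$ isomorphic to a direct summand of $M$ is itself a direct summand of $M$. A linear Hausdorff topology on $R$ is a ring topology with a basis $\mathfrak U$ of neighborhoods of $0$ consisting of left ideals, with $\bigcap_{U\in\mathfrak U}U=0$. A family $\{x_i\}_{i\in I}\subseteq R$ is summable to $r$ if for every $U\in\mathfrak U$ there is a finite $F'\subseteq I$ with $\sum_{i\in F}x_i-r\in U$ for all finite $F$ with $F'\subseteq F\subseteq I$ (write $\sum_{i\in I}x_i=r$; the family is then called summable). The topology is nice if it is linear, Hausdorff, and for every summable family $\{x_i\}_{i\in I}$ and every family $\{r_i\}_{i\in I}\subseteq R$ the family $\{r_ix_i\}_{i\in I}$ is summable. For a cardinal $\aleph$, $R$ is an $\aleph$-exchange ring if for every family $\{x_i\}_{i\in I}$ with $|I|\le\aleph$ summable to $1$ there exist pairwise orthogonal idempotents $e_i\in Rx_i$ forming a summable family with $\sum_{i\in I}e_i=1$; $R$ is a full exchange ring if it is an $\aleph$-exchange ring for every cardinal $\aleph$. *)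

(* Defs.v *)
From mathcomp Require Import all_boot all_algebra.
From Stdlib Require List.
Set Implicit Arguments. Unset Strict Implicit. Unset Printing Implicit Defensive.
Import GRing.Theory.
Local Open Scope ring_scope.

Definition dedekind_finite (R : pzRingType) : Prop :=
  forall x y : R, x * y = 1 -> y * x = 1.

Definition right_ideal (R : pzRingType) (A : R -> Prop) : Prop :=
  A 0 /\ (forall a b, A a -> A b -> A (a + b)) /\ (forall a r, A a -> A (a * r)).

Definition left_ideal (R : pzRingType) (A : R -> Prop) : Prop :=
  A 0 /\ (forall a b, A a -> A b -> A (a + b)) /\ (forall a r, A a -> A (r * a)).

Definition maximal_right_ideal (R : pzRingType) (M : R -> Prop) : Prop :=
  right_ideal M /\ ~ M 1 /\
  forall N : R -> Prop, right_ideal N -> (forall x, M x -> N x) ->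
    N 1 \/ (forall x, N x -> M x).

Definition jacobson (R : pzRingType) (x : R) : Prop :=
  forall M : R -> Prop, maximal_right_ideal M -> M x.

Definition pi_regular_mod_J (R : pzRingType) : Prop :=
  forall x : R, exists n : nat, (0 < n)%N /\
    exists y : R, jacobson (x ^+ n - x ^+ n * y * x ^+ n).

Definition idempotents_lift_mod_J (R : pzRingType) : Prop :=
  forall x : R, jacobson (x * x - x) ->
    exists e : R, e * e = e /\ jacobson (e - x).

Definition semi_pi_regular (R : pzRingType) : Prop :=
  pi_regular_mod_J R /\ idempotents_lift_mod_J R.

Definition direct_summand_RR (R : pzRingType) (B : R -> Prop) : Prop :=
  right_ideal B /\ exists C : R -> Prop, right_ideal C /\
    (forall x, B x -> C x -> x = 0) /\
    (forall x, exists b c, B b /\ C c /\ x = b + c).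

Definition iso_submodules (R : pzRingType) (A B : R -> Prop) : Prop :=
  exists f : R -> R,
    (forall a b, B a -> B b -> f (a + b) = f a + f b) /\
    (forall a r, B a -> f (a * r) = f a * r) /\
    (forall a, B a -> A (f a)) /\
    (forall a b, B a -> B b -> f a = f b -> a = b) /\
    (forall c, A c -> exists a, B a /\ f a = c).

Definition C2_right (R : pzRingType) : Prop :=
  forall A B : R -> Prop, right_ideal A -> direct_summand_RR B ->
    iso_submodules A B -> direct_summand_RR A.

(* U is a basis of neighbourhoods of 0 of a linear Hausdorff ring topology:
   a filter base of left ideals, compatible with right multiplication
   (continuity of multiplication), with zero intersection. *)
Definition linear_hausdorff_basis (R : pzRingType) (U : (R -> Prop) -> Prop) : Prop :=
  (exists V, U V) /\
  (forall V, U V -> left_ideal V) /\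
  (forall V1 V2, U V1 -> U V2 -> exists V3, U V3 /\ forall x, V3 x -> V1 x /\ V2 x) /\
  (forall V (r : R), U V -> exists W, U W /\ forall x, W x -> V (x * r)) /\
  (forall x : R, (forall V, U V -> V x) -> x = 0).

(* Finite subsets of I are duplicate-free lists. *)
Definition summable_to (R : pzRingType) (U : (R -> Prop) -> Prop)
    (I : Type) (x : I -> R) (r : R) : Prop :=
  forall V, U V -> exists F' : list I, List.NoDup F' /\
    forall F : list I, List.NoDup F -> (forall i, List.In i F' -> List.In i F) ->
      V (\sum_(i <- F) x i - r).

Definition summable (R : pzRingType) (U : (R -> Prop) -> Prop)
    (I : Type) (x : I -> R) : Prop :=
  exists r, summable_to U x r.

Definition nice_topology (R : pzRingType) (U : (R -> Prop) -> Prop) : Prop :=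
  linear_hausdorff_basis U /\
  forall (I : Type) (x r : I -> R), summable U x -> summable U (fun i => r i * x i).

(* aleph-exchange for every cardinal aleph = for every index type I. *)
Definition full_exchange (R : pzRingType) (U : (R -> Prop) -> Prop) : Prop :=
  forall (I : Type) (x : I -> R), summable_to U x 1 ->
    exists e : I -> R,
      (forall i, e i * e i = e i) /\
      (forall i j, i <> j -> e i * e j = 0) /\
      (forall i, exists s : R, e i = s * x i) /\
      summable_to U e 1.

(* Main.v *)
(** Well-order [I] and work modulo the Jacobson radical [J].  One chooses
    idempotents [e i] in [R x_i] with [e i * e j] in [J] for [i < j], keeping the
    invariant that any [z] killed modulo [J] by the [e i] chosen so far satisfies
    [z = s y z] modulo [J], where [y] is the sum of the remaining [x_i].  At each
    stage semi-pi-regularity, applied to the sum [phi] of the chosen [e i], gives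
    an idempotent [g] with [e i * g] in [J] and [1 - g] in [R phi].  At limit
    stages the topology shows that left multiplication by [y] is injective on
    [g R], so (C2) splits it; at successor stages [g] is split by the usual
    pi-regular exchange argument.  When all of [I] is used up, [phi] is invertible,
    and [phi^-1 e i] are orthogonal idempotents modulo [J] with sum 1.  They are in
    fact exactly orthogonal: the defects lie in [J], and modulo an open left
    ideal finitely many of them generate all the others, so Nakayama's lemma kills
    them. *)
From Stdlib Require List.
From Stdlib Require Import Ncring Ncring_tac.
Require Import Defs.
From mathcomp Require Import all_boot all_algebra.
From mathcomp Require Import boolp classical_sets wochoice.
Set Implicit Arguments. Unset Strict Implicit. Unset Printing Implicit Defensive.
Import GRing.Theory.
Local Open Scope ring_scope.

Section FullExchange.
Context {R : pzRingType}.
Implicit Types (x y z a b g r s t : R) (V W : R -> Prop).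

(* These instances make [non_commutative_ring] available on [R]. *)
#[local] Instance pzRing_ops :
  @Ring_ops R 0 1 +%R *%R (fun x y => x - y) -%R (@eq R) := {}.

#[local] Instance pzRing_Ring : Ring (Ro := pzRing_ops).
Proof.
split; try exact: eq_equivalence; try (by move=> ? ? -> ? ? ->); try by move=> ? ? ->.
- exact: add0r.
- exact: addrC.
- exact: addrA.
- exact: mul1r.
- exact: mulr1.
- exact: mulrA.
- exact: mulrDl.
- move=> x y z; exact: mulrDr.
- by [].
- exact: subrr.
Qed.

(** * The Jacobson radical through one-sided inverses *)

Lemma maximal_right_ideal_above (A : R -> Prop) :
  right_ideal A -> ~ A 1 -> exists M, maximal_right_ideal M /\ forall x, A x -> M x.
Proof.
move=> [A0 [AD AM]] A1.
(* Zorn also asks about the union of the empty chain; stating [P] for the union of [A] and [X] makes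
   that case reduce to [A] itself. *)
pose P (X : set R) := right_ideal (fun x => A x \/ X x) /\ ~ X 1.
have [|M [[Mid M1] Mmax]] := @Zorn_bigcup R P.
  move=> F FP Ftot; split; last by case=> X FX; apply: (FP _ FX).2.
  split; first by left.
  split=> [a b [Aa|[X FX Xa]] [Ab|[Y FY Yb]]|a r [Aa|[X FX Xa]]].
  - by left; apply: AD.
  - have [[_ [h _]] _] := FP _ FY.
    by have [|?] := h a b (or_introl Aa) (or_intror Yb); [left|right; exists Y].
  - have [[_ [h _]] _] := FP _ FX.
    by have [|?] := h a b (or_intror Xa) (or_introl Ab); [left|right; exists X].
  - have [XY|YX] := Ftot _ _ FX FY.
      have [[_ [h _]] _] := FP _ FY.
      by have [|?] := h a b (or_intror (XY _ Xa)) (or_intror Yb);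
        [left|right; exists Y].
    have [[_ [h _]] _] := FP _ FX.
    by have [|?] := h a b (or_intror Xa) (or_intror (YX _ Yb));
      [left|right; exists X].
  - by left; apply: AM.
  - have [[_ [_ h]] _] := FP _ FX.
    by have [|?] := h a r (or_intror Xa); [left|right; exists X].
exists (fun x => A x \/ M x); split; last by left.
split=> //; split; first by case.
move=> N Nid MN; have [|N1] := pselect (N 1); [by left|right=> x Nx].
apply: contrapT => nMx; apply: (Mmax N); last first.
  split=> //; suff -> : (fun x => A x \/ N x) = N by [].
  by apply/funext => y; apply/propext; split; [case=> // Ay; apply: MN; left|right].
split; first by move=> y My; apply: MN; right.
by move=> /(_ _ Nx) Mx; apply: nMx; right.
Qed.

Lemma jacobson_right_ideal : right_ideal (@jacobson R).
Proof.
split; first by move=> M [[]].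
split=> [a b Ja Jb M Mm|a r Ja M Mm].
  by have [[_ [MD _]] _] := Mm; apply: MD; [apply: Ja|apply: Jb].
by have [[_ [_ MM]] _] := Mm; apply: MM; apply: Ja.
Qed.

Lemma jacobsonP (j : R) : jacobson j <-> forall r, exists u, (1 - j * r) * u = 1.
Proof.
split=> [Jj r|inv M Mm].
  apply: contrapT => ninv; have [||M [Mm AM]] :=
      @maximal_right_ideal_above (fun x => exists u, (1 - j * r) * u = x).
  - split; first by exists 0; rewrite mulr0.
    split=> [a b [u <-] [v <-]|a s [u <-]].
      by exists (u + v); rewrite mulrDr.
    by exists (u * s); rewrite mulrA.
  - by [].
  have [[_ [MD MM]] [M1 _]] := Mm; apply: M1.
  rewrite -[1](subrK (j * r)); apply: MD; last by apply: MM; apply: Jj.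
  by apply: AM; exists 1; rewrite mulr1.
have [[M0 [MD MM]] [M1 Mmax]] := Mm.
pose N x := exists m r, M m /\ x = m + j * r.
have [||[m [r [Mmm E]]]|NM] := Mmax N.
- split; first by exists 0, 0; rewrite mulr0 addr0.
  split=> [_ _ [m [r [? ->]]] [m' [r' [? ->]]]|_ s [m [r [? ->]]]].
    by exists (m + m'), (r + r'); split; [apply: MD|rewrite mulrDr addrACA].
  by exists (m * s), (r * s); split; [apply: MM|rewrite mulrDl mulrA].
- by move=> m Mm'; exists m, 0; rewrite mulr0 addr0.
- have [u Hu] := inv r; case: M1; rewrite -Hu E addrK; exact: MM.
by apply: NM; exists 0, 1; rewrite mulr1 add0r.
Qed.

Lemma jacobson0 : jacobson (0 : R).
Proof. by have [] := jacobson_right_ideal. Qed.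

Lemma jacobsonD a b : jacobson a -> jacobson b -> jacobson (a + b).
Proof. by have [_ [h _]] := jacobson_right_ideal; apply: h. Qed.

Lemma jacobsonMr a r : jacobson a -> jacobson (a * r).
Proof. by have [_ [_ h]] := jacobson_right_ideal; apply: h. Qed.

Lemma jacobsonN a : jacobson a -> jacobson (- a).
Proof. by move=> Ja; rewrite -[a]mulr1 -mulrN; apply: jacobsonMr. Qed.

Lemma jacobsonB a b : jacobson a -> jacobson b -> jacobson (a - b).
Proof. by move=> Ja Jb; apply: jacobsonD => //; apply: jacobsonN. Qed.

(** The witness [1 + a * u * b] comes from summing the powers of [a * b] as a formal geometric
    series. This is what makes J absorb multiplication on the left. *)
Lemma right_inverse_swap a b :
  (exists u, (1 - b * a) * u = 1) -> exists u, (1 - a * b) * u = 1.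
Proof.
case=> u Hu; exists (1 + a * u * b).
have -> : (1 - a * b) * (1 + a * u * b) = 1 - a * b + a * ((1 - b * a) * u) * b.
  by non_commutative_ring.
by rewrite Hu mulr1 subrK.
Qed.

Lemma jacobsonMl r a : jacobson a -> jacobson (r * a).
Proof.
move=> Ja; apply/jacobsonP => s; rewrite -mulrA; apply: right_inverse_swap.
by rewrite -mulrA; apply: (proj1 (jacobsonP a)).
Qed.

Hypothesis dfR : dedekind_finite R.

Lemma jacobson_left_inverse (j : R) : jacobson j -> exists u, u * (1 - j) = 1.
Proof.
move=> /jacobsonP/(_ 1)[u]; rewrite mulr1 => /dfR Hu; by exists u.
Qed.

Lemma jacobson_of_left_inverse (j : R) :
  (forall r, exists u, u * (1 - r * j) = 1) -> jacobson j.
Proof.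
move=> inv; apply/jacobsonP => r; apply: right_inverse_swap.
by have [u /dfR Hu] := inv r; exists u.
Qed.

(** * Exact idempotents and splittings from congruences modulo J *)

Lemma idempotent_jacobson g : g * g = g -> jacobson g -> g = 0.
Proof.
move=> gg /jacobson_left_inverse[u Hu].
by rewrite -[g]mul1r -Hu -mulrA mulrBl mul1r gg subrr mulr0.
Qed.

(** Here [g * s * g = (1 - j) * g] with [j = g * (g - s * g) * g] in J, so a left inverse of [1 - j]
    turns the congruence into an equality. *)
Lemma idempotent_factor_lift g s : g * g = g -> jacobson (g - s * g) ->
  exists t, g * t = t /\ t * s * g = g.
Proof.
move=> gg J1.
have /jacobson_left_inverse[u Hu] : jacobson (g * (g - s * g) * g).
  by apply: jacobsonMr; apply: jacobsonMl.
exists (g * u * g); split; first by rewrite !mulrA gg.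
have E : (1 - g * (g - s * g) * g) * g = g * s * g.
  have -> : (1 - g * (g - s * g) * g) * g =
      g - g * g * g * g + g * s * (g * g) * g.
    by non_commutative_ring.
  by rewrite -!mulrA !gg subrr add0r.
have -> : g * u * g * s * g = g * (u * (g * s * g)) by rewrite !mulrA.
by rewrite -E [u * _]mulrA Hu mul1r gg.
Qed.

Hypothesis spR : semi_pi_regular R.

(** With [x] the power of [a], an idempotent [f] lifting [y * x] is in [R x] only modulo J.
    Factoring [f] through [y * x] gives [e = t * y * x], truly in [R x], with [f * e = e] and
    [e * f = f]; hence [e] is idempotent. *)
Lemma pi_regular_idempotent a : exists n p e, [/\ e = p * a ^+ n.+1, e * e = e
  & jacobson (a ^+ n.+1 * (1 - e))].
Proof.
have [pireg lift] := spR.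
have [m [m0 [y Jy]]] := pireg a; case: m m0 Jy => [//|n] _ Jy.
exists n; move: (a ^+ n.+1) Jy => x Jy.
have [|f [ff Jf]] := lift (y * x).
  have -> : y * x * (y * x) - y * x = y * (- (x - x * y * x)) by non_commutative_ring.
  by apply: jacobsonMl; apply: jacobsonN.
have [|t [ft tf]] := @idempotent_factor_lift f (y * x) ff.
  have -> : f - y * x * f = (f - y * x) * f.
    by rewrite mulrBl ff.
  exact: jacobsonMr.
have fe : f * (t * y * x) = t * y * x by rewrite !mulrA ft.
have ef : t * y * x * f = f by rewrite -[t * y * x]mulrA tf.
exists (t * y), (t * y * x); split=> //.
  by rewrite -{2}fe mulrA ef fe.
have Jxf : jacobson (x - x * f).
  have -> : x - x * f = (x - x * y * x) - x * (f - y * x) by non_commutative_ring.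
  by apply: jacobsonB => //; apply: jacobsonMl.
have -> : x * (1 - t * y * x) =
    x - x * f + x * (f - t * y * x * f) - x * t * y * (x - x * f).
  by non_commutative_ring.
rewrite ef subrr mulr0 addr0; apply: jacobsonB => //; exact: jacobsonMl.
Qed.

Hypothesis c2R : C2_right R.

(** By injectivity [c g R] is isomorphic to the summand [g R], so it has a complement [C]. Writing
    [1 = c * g * v + d] with [d] in [C], the element [c * g - c * g * v * c * g = d * c * g] lies in
    both summands, hence is 0; cancelling [c] gives [t = g * v]. *)
Lemma C2_left_inverse g c : g * g = g ->
  (forall m, c * g * m = 0 -> g * m = 0) -> exists t, t * c * g = g.
Proof.
move=> gg inj.
pose A x := exists r, x = c * g * r; pose B x := g * x = x.
have [|||_ [C [[C0 [CD CM]] [AC0 ACs]]]] := c2R (A := A) (B := B).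
- split; first by exists 0; rewrite mulr0.
  split=> [_ _ [r ->] [s ->]|_ s [r ->]].
    by exists (r + s); rewrite mulrDr.
  by exists (r * s); rewrite mulrA.
- have id h : right_ideal (fun x => h * x = x).
    split; first exact: mulr0.
    by split=> [a b ha hb|a r ha]; rewrite ?mulrDr ?ha ?hb ?mulrA ?ha.
  have idg : (1 - g) * (1 - g) = 1 - g.
    by rewrite mulrBr mulr1 mulrBl mul1r gg subrr subr0.
  split; first exact: id.
  exists (fun x => (1 - g) * x = x); split; first exact: id.
  split=> [x <- <-|x]; first by rewrite mulrA mulrBl mul1r gg subrr mul0r.
  exists (g * x), ((1 - g) * x); rewrite /B mulrA gg; split=> //; split.
    by rewrite mulrA idg.
  by rewrite -mulrDl subrKC mul1r.
- exists ( *%R c); split; first by move=> *; exact: mulrDr.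
  split; first by move=> *; exact: mulrA.
  split; first by move=> b Bb; exists b; rewrite -mulrA Bb.
  split=> [a b Ba Bb E|_ [r ->]]; last by exists (g * r); rewrite /B !mulrA gg.
  apply/eqP; rewrite -subr_eq0 -[a]Ba -[b]Bb -mulrBr; apply/eqP/inj.
  by rewrite -mulrA mulrBr Ba Bb mulrBr E subrr.
have [_ [d [[v ->] [Cd E1]]]] := ACs 1.
exists (g * v); have Em : c * g * (1 - v * (c * g)) = d * (c * g).
  by rewrite -[c * g in RHS]mul1r [in RHS]mulrA -(addKr (c * g * v) d) -E1; non_commutative_ring.
have /AC0 H : A (c * g * (1 - v * (c * g))) by eexists.
have /inj : c * g * (1 - v * (c * g)) = 0 by apply: H; rewrite Em; apply: CM.
by rewrite mulrBr mulr1 !mulrA => /eqP; rewrite subr_eq0 => /eqP.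
Qed.

(** * Summable families *)

Context (U : (R -> Prop) -> Prop) (niceU : nice_topology U).

Lemma nbhs_left_ideal V : U V -> left_ideal V.
Proof. by have [[_ [h _]] _] := niceU; apply: h. Qed.

Lemma nbhsD V a b : U V -> V a -> V b -> V (a + b).
Proof. by move=> /nbhs_left_ideal[_ [h _]]; apply: h. Qed.

Lemma nbhsMl V r a : U V -> V a -> V (r * a).
Proof. by move=> /nbhs_left_ideal[_ [_ h]]; apply: h. Qed.

Lemma nbhs0 V : U V -> V 0.
Proof. by move=> /nbhs_left_ideal[]. Qed.

Lemma nbhsB V a b : U V -> V a -> V b -> V (a - b).
Proof. by move=> UV Va Vb; apply: nbhsD => //; rewrite -mulN1r; apply: nbhsMl. Qed.

Lemma nbhs_sum V (I : Type) (F : seq I) (w : I -> R) :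
  U V -> (forall i, List.In i F -> V (w i)) -> V (\sum_(i <- F) w i).
Proof.
move=> UV; elim: F => [_|i F IH VF]; first by rewrite big_nil; apply: nbhs0.
rewrite big_cons; apply: nbhsD => //; first by apply: VF; left.
by apply: IH => k kF; apply: VF; right.
Qed.

Lemma nbhs_mulr V r : U V -> exists W, U W /\ forall x, W x -> V (x * r).
Proof. by have [[_ [_ [_ [h _]]]] _] := niceU; apply: h. Qed.

Lemma nbhs_separated x : (forall V, U V -> V x) -> x = 0.
Proof. by have [[_ [_ [_ [_ h]]]] _] := niceU; apply: h. Qed.

Section Summability.
Context {I : eqType}.
Implicit Types (i j : I) (w v : I -> R) (A : pred I) (F : seq I).

Lemma NoDup_union F1 F2 : exists F, List.NoDup F /\
  forall i, List.In i F1 \/ List.In i F2 -> List.In i F.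
Proof.
exists (List.nodup (@eq_comparable I) (F1 ++ F2)); split; first exact: List.NoDup_nodup.
by move=> i iF; rewrite List.nodup_In; apply: List.in_or_app.
Qed.

Lemma eq_summable_to w v r : w =1 v -> summable_to U w r -> summable_to U v r.
Proof. by move=> wv; have -> : w = v by apply/funext. Qed.

Lemma summable_toD w v r s : summable_to U w r -> summable_to U v s ->
  summable_to U (fun i => w i + v i) (r + s).
Proof.
move=> sw sv V UV; have [F1 [_ H1]] := sw V UV; have [F2 [_ H2]] := sv V UV.
have [F' [ndF' sF']] := NoDup_union F1 F2; exists F'; split=> // F ndF sF.
rewrite big_split opprD addrACA; apply: nbhsD => //.
  by apply: H1 => // i Fi; apply/sF/sF'; left.
by apply: H2 => // i Fi; apply/sF/sF'; right.
Qed.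

Lemma summable_toMl a w r : summable_to U w r -> summable_to U (fun i => a * w i) (a * r).
Proof.
move=> sw V UV; have [F' [ndF' H]] := sw V UV; exists F'; split=> // F ndF sF.
by rewrite -mulr_sumr -mulrBr; apply: nbhsMl => //; apply: H.
Qed.

Lemma summable_toMr a w r : summable_to U w r -> summable_to U (fun i => w i * a) (r * a).
Proof.
move=> sw V UV; have [W [UW WV]] := nbhs_mulr a UV.
have [F' [ndF' H]] := sw W UW; exists F'; split=> // F ndF sF.
by rewrite -mulr_suml -mulrBl; apply: WV; apply: H.
Qed.

Lemma summable_toB w v r s : summable_to U w r -> summable_to U v s ->
  summable_to U (fun i => w i - v i) (r - s).
Proof.
move=> sw /(summable_toMl (-1)) sv; have := summable_toD sw sv.
by rewrite mulN1r; apply: eq_summable_to => i; rewrite mulN1r.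
Qed.

Lemma summable_to_single j a : summable_to U (fun i : I => if i == j then a else 0) a.
Proof.
move=> V UV; exists [:: j]; split.
  by apply: List.NoDup_cons => //; apply: List.NoDup_nil.
move=> F ndF sF; suff -> : \sum_(i <- F) (if i == j then a else 0) = a.
  by rewrite subrr; apply: nbhs0.
have {sF} : List.In j F by apply: sF; left.
elim: ndF => [[]|i {}F iF ndF IH] /= jF; rewrite big_cons.
have [ij|ij] := eqVneq i j; last first.
  by rewrite add0r; apply: IH; case: jF => // E; rewrite E eqxx in ij.
suff -> : \sum_(k <- F) (if k == j then a else 0) = 0 by rewrite addr0.
rewrite {}ij in iF; elim: F iF {ndF IH jF} => [|k F IH] jF; first by rewrite big_nil.
rewrite big_cons IH; last by move=> ?; apply: jF; right.
by case: eqP jF => [-> []|]; [left|rewrite addr0].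
Qed.

Lemma summable_to_cauchy w r V : summable_to U w r -> U V ->
  exists F, forall i, ~ List.In i F -> V (w i).
Proof.
move=> sw UV; have [F [ndF H]] := sw V UV; exists F => i iF.
have -> : w i = (\sum_(k <- i :: F) w k - r) - (\sum_(k <- F) w k - r).
  by rewrite big_cons opprB addrA subrK addrK.
apply: nbhsB => //; last exact: H.
by apply: H => [|k kF]; [apply: List.NoDup_cons|right].
Qed.

Lemma summable_to_mem w r V : summable_to U w r -> U V -> (forall i, V (w i)) -> V r.
Proof.
move=> sw UV wV; have [F [ndF H]] := sw V UV.
rewrite -[r](subKr (\sum_(i <- F) w i)); apply: nbhsB => //; last exact: H.
exact: nbhs_sum.
Qed.

(* If [(1 - s * r) * m = 0], then modulo any open left ideal [m] is killed by
   [1 - s * j] for a finite partial sum [j] of [w], which is a unit: so [m = 0]. *)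
Lemma summable_to_jacobson w r :
  summable_to U w r -> (forall i, jacobson (w i)) -> jacobson r.
Proof.
move=> sw Jw; apply: jacobson_of_left_inverse => s.
suff [t] : exists t, t * (1 - s * r) * 1 = 1 by rewrite mulr1; exists t.
apply: C2_left_inverse => [|m]; first by rewrite mulr1.
rewrite mulr1 mul1r => m0; apply: nbhs_separated => V UV.
have [W [UW WV]] := nbhs_mulr m UV; have [F [ndF H]] := sw W UW.
have /jacobson_left_inverse[u Hu] : jacobson (s * \sum_(i <- F) w i).
  apply: jacobsonMl; elim: F {ndF H} => [|i F IH]; first by rewrite big_nil; apply: jacobson0.
  by rewrite big_cons; apply: jacobsonD.
rewrite -[m]mul1r -Hu -mulrA; apply: nbhsMl => //.
have -> : (1 - s * \sum_(i <- F) w i) * m =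
    (1 - s * r) * m - s * ((\sum_(i <- F) w i - r) * m) by non_commutative_ring.
by rewrite m0; apply: nbhsB => //; [apply: nbhs0|apply: nbhsMl => //; apply: WV; apply: H].
Qed.

Definition restrict A w i := if A i then w i else 0.

(** The one use of niceness beyond the linear Hausdorff axioms, with coefficients 0 off [A]. It
    provides the sums of the chosen idempotents as well as those of the remaining [x i]. *)
Lemma summable_restrict A w v r : summable_to U v r ->
  (forall i, A i -> exists s, w i = s * v i) -> exists s, summable_to U (restrict A w) s.
Proof.
move=> sv wv; have [_ /(_ I v) nice] := niceU.
have /choice[c Hc] : forall i, exists s, restrict A w i = s * v i.
  by rewrite /restrict => i; case: ifP => [/wv|_] //; exists 0; rewrite mul0r.
have [|s sc] := nice c; first by exists r.
by exists s; move: sc; apply: eq_summable_to => i; rewrite Hc.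
Qed.

End Summability.

(** * Transfinite choice of the idempotents *)

Section Transfinite.
Context {I : eqType} (lt : rel I) (lt_wf : well_founded lt)
  (lt_trans : transitive lt) (lt_total : forall i j, i <> j -> lt i j \/ lt j i).
Context (x : I -> R) (sum_x : summable_to U x 1).
Implicit Types (i j k : I) (e w : I -> R) (A B : pred I) (F : seq I).

Lemma lt_neq i j : lt i j -> (i == j) = false.
Proof.
move=> ij; apply/eqP => E; rewrite {}E in ij.
by elim/(well_founded_ind lt_wf): j ij => j IH jj; apply: (IH j).
Qed.

Definition triangular e A := [/\ forall i, A i -> exists s, e i = s * x i,
  forall i, A i -> e i * e i = e i
  & forall i k, A i -> A k -> lt i k -> jacobson (e i * e k)].

(** For empty [A] this is trivial, as [y = 1] works. For [A] everything, [y = 0], and it says that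
    only elements of J are killed. *)
Definition exhausts e A := forall z, (forall i, A i -> jacobson (e i * z)) ->
  exists y s, summable_to U (restrict (predC A) x) y /\ jacobson (z - s * y * z).

(* Modulo [J], [e i * phi] is [e i + e i * sum_(k < i) e k]; hence, by well-founded
   induction, an element killed by a power of [phi] is killed by every [e i]. *)
Lemma triangular_kernel e A phi :
  triangular e A -> summable_to U (restrict A e) phi ->
  exists g q, [/\ g * g = g, 1 - g = q * phi & forall i, A i -> jacobson (e i * g)].
Proof.
move=> [_ ee etri] sphi.
have [n [p [f [fE ff Jf]]]] := pi_regular_idempotent phi.
exists (1 - f), (p * phi ^+ n); split.
- by rewrite mulrBr mulr1 mulrBl mul1r ff subrr subr0.
- by rewrite subKr fE exprSr mulrA.
suff H i : A i -> forall m, jacobson (e i * (phi ^+ m * (1 - f))).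
  by move=> i Ai; have := H i Ai 0%N; rewrite expr0 mul1r.
elim/(well_founded_ind lt_wf): i => i IH Ai; set g := 1 - f in Jf IH *.
have step m : jacobson (e i * (phi ^+ m.+1 * g) - e i * (phi ^+ m * g)).
  have sw := summable_toB (summable_toMr (phi ^+ m * g) (summable_toMl (e i) sphi))
    (summable_to_single i (e i * (phi ^+ m * g))).
  have -> : e i * (phi ^+ m.+1 * g) = e i * phi * (phi ^+ m * g) by rewrite exprS !mulrA.
  apply: summable_to_jacobson sw _ => k; rewrite /restrict.
  case: eqP => [->|/lt_total[ki|ik]]; last 2 first.
  - rewrite subr0; case: ifP => [Ak|_]; last by rewrite mulr0 !mul0r; apply: jacobson0.
    by rewrite -!mulrA; apply: jacobsonMl; apply: IH.
  - rewrite subr0; case: ifP => [Ak|_]; last by rewrite mulr0 !mul0r; apply: jacobson0.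
    by apply: jacobsonMr; apply: etri.
  by rewrite Ai ee // subrr; apply: jacobson0.
(* By [step], membership in J passes from exponent [n.+1], where [Jf] gives it, down to 0, and then
   up to every [m], as the induction on [i] requires. *)
have H0 : jacobson (e i * (phi ^+ 0 * g)).
  have : jacobson (e i * (phi ^+ n.+1 * g)) by apply: jacobsonMl.
  elim: n.+1 => // m IHm Jm; apply: IHm.
  rewrite -[X in jacobson X](subKr (e i * (phi ^+ m.+1 * g))).
  exact: jacobsonB.
elim=> // m Jm; rewrite -[X in jacobson X](subrK (e i * (phi ^+ m * g))).
exact: jacobsonD.
Qed.

(** [(1 - g) * z = q * phi * z], and [phi * z] is a sum of elements [e i * z] of J. Questions about
    [z] thus reduce to the single idempotent [g]. *)
Lemma triangular_reduce e A phi q g z : summable_to U (restrict A e) phi ->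
  1 - g = q * phi -> (forall i, A i -> jacobson (e i * z)) -> jacobson (z - g * z).
Proof.
move=> sphi gE Jz; rewrite -[z in z - _]mul1r -mulrBl gE -mulrA; apply: jacobsonMl.
apply: summable_to_jacobson (summable_toMr z sphi) _ => i; rewrite /restrict.
by case: ifP => [/Jz|_] //; rewrite mul0r; apply: jacobson0.
Qed.

Lemma triangular_summable e A : triangular e A ->
  exists phi, summable_to U (restrict A e) phi.
Proof. by case=> ex _ _; apply: summable_restrict sum_x _. Qed.

(** The limit stage. If [y * g * m = 0], take [B] containing the finitely many indices of [A] whose
    [x i] is not small. With [y'] the sum off [B], [g * m] is a left multiple of [(y' - y) * g * m],
    and [y' - y] sums only small terms; so [g * m = 0] and (C2) inverts [y] on [g R]. *)
Lemma exhausts_directed e A : triangular e A ->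
  (forall F, (forall i, List.In i F -> A i) -> exists B,
    [/\ forall i, List.In i F -> B i, forall i, B i -> A i & exhausts e B]) ->
  exhausts e A.
Proof.
move=> tri dirA z Jz; have [phi sphi] := triangular_summable tri.
have [g [q [gg gE Jg]]] := triangular_kernel tri sphi.
have [|y sy] := @summable_restrict _ (predC A) x x 1 sum_x.
  by move=> i _; exists 1; rewrite mul1r.
have [m ygm0|t tyg] := @C2_left_inverse g y gg.
  apply: nbhs_separated => V UV; have [W [UW WV]] := nbhs_mulr (g * m) UV.
  have [F xF] := summable_to_cauchy sum_x UW.
  have [|B [FB BA exB]] := dirA (List.filter A F).
    by move=> i /List.filter_In[].
  have [|y' [s [sy' Js]]] := exB g; first by move=> i /BA/Jg.
  have [t [_ Ht]] := idempotent_factor_lift gg Js.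
  rewrite -Ht; have -> : t * (s * y') * g * m =
      t * s * ((y' - y) * (g * m)) + t * s * (y * g * m).
    by non_commutative_ring.
  rewrite ygm0 mulr0 addr0; apply: nbhsMl => //; apply: WV.
  apply: (summable_to_mem (summable_toB sy' sy) UW) => i; rewrite /restrict /=.
  have [Bi|nBi] := boolP (B i); first by rewrite (BA _ Bi) /= subrr; apply: nbhs0.
  have [Ai|nAi] := boolP (A i); last by rewrite /= subrr; apply: nbhs0.
  rewrite /= subr0; apply: xF => iF; move/negP: nBi; apply; apply: FB.
  by apply/List.filter_In.
exists y, t; split=> //.
have -> : z - t * y * z = (z - g * z) - t * y * (z - g * z) + (g - t * y * g) * z.
  by non_commutative_ring.
rewrite tyg subrr mul0r addr0.
have Jgz := triangular_reduce sphi gE Jz.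
by apply: jacobsonB => //; apply: jacobsonMl.
Qed.

(* With [g = s * y * g], the element [b = s * x l * g] of the corner ring [g R g]
   yields [g = e0 + h] with [e0] in [R b] and [b ^+ n.+1 * h] in [J]; as
   [1 - b ^+ n.+1] is a left multiple of [1 - b], [h] is a left multiple of
   [(y - x l) * h] modulo [J]. *)
Lemma exhausts_step e A l : triangular e A -> exhausts e A -> ~~ A l ->
  exists r, [/\ exists s, r = s * x l, r * r = r, forall i, A i -> jacobson (e i * r)
  & forall e', (forall i, A i -> e' i = e i) -> e' l = r ->
      exhausts e' (fun i => (i == l) || A i)].
Proof.
move=> tri exA nAl; have [phi sphi] := triangular_summable tri.
have [g [q [gg gE Jg]]] := triangular_kernel tri sphi.
have [y [s0 [sy Js]]] := exA g Jg.
have [t [gt Ht]] := idempotent_factor_lift gg Js.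
pose s := t * s0.
have gs : g * s = s by rewrite mulrA gt.
have {Js Ht} syg : s * y * g = g by rewrite -[RHS]Ht !mulrA.
clearbody s; have [b bE] : exists b, b = s * x l * g by eexists.
have bg : b * g = b by rewrite bE -mulrA gg.
have [n [p [f [fE ff Jf]]]] := pi_regular_idempotent b.
have bng : b ^+ n.+1 * g = b ^+ n.+1 by rewrite exprSr -mulrA bg.
have fg : f * g = f by rewrite fE -mulrA bng.
have [e0 e0E] : exists e0 : R, e0 = g * f by eexists.
have e0e0 : e0 * e0 = e0 by rewrite e0E mulrA -(mulrA g) fg -mulrA ff.
have ge0 : g * e0 = e0 by rewrite e0E mulrA gg.
(* [e0] is a left multiple of [x l * g]; dropping the final [g] gives [r] in [R x l]. Then
   [r * g = e0] and [e0 * r = r] make [r] idempotent. *)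
have [r rE] : exists r, r = e0 * (g * p * b ^+ n * s) * x l by eexists.
have rg : r * g = e0.
  have -> : r * g = e0 * (g * p * b ^+ n * s * x l * g) by rewrite rE !mulrA.
  suff -> : g * p * b ^+ n * s * x l * g = e0 by [].
  by rewrite e0E fE exprSr {3}bE !mulrA.
have e0r : e0 * r = r by rewrite rE !mulrA e0e0.
have gr : g * r = r by rewrite rE !mulrA ge0.
exists r; split.
- by exists (e0 * (g * p * b ^+ n * s)).
- by rewrite -{2}e0r -{1}ge0 !mulrA rg e0e0 e0r.
- by move=> i Ai; rewrite -gr mulrA; apply: jacobsonMr; apply: Jg.
move=> e' e'A e'l z Jz.
have {}Jz1 : jacobson (z - g * z).
  apply: triangular_reduce sphi gE _ => i Ai.
  by rewrite -e'A //; apply: Jz; rewrite Ai orbT.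
have Jrz : jacobson (r * z) by rewrite -e'l; apply: Jz; rewrite eqxx.
pose h := g - e0.
(* [e0 * z = r * g * z] is congruent to [r * z], which lies in J. *)
have Jhz : jacobson (z - h * z).
  have -> : z - h * z = (z - g * z) + (r * z - r * (z - g * z)) + (e0 - r * g) * z.
    by rewrite /h; non_commutative_ring.
  rewrite rg subrr mul0r addr0; apply: jacobsonD => //; apply: jacobsonB => //.
  exact: jacobsonMl.
have [c Ec] : exists c, 1 - b ^+ n.+1 = c * (1 - b).
  elim: n.+1 => [|m [c Ec]]; first by exists 0; rewrite expr0 subrr mul0r.
  exists (1 + c * b); rewrite exprSr.
  have -> : 1 - b ^+ m * b = (1 - b) + (1 - b ^+ m) * b by non_commutative_ring.
  by rewrite Ec; non_commutative_ring.
have gh : g * h = h by rewrite mulrBr gg ge0.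
have Eh : (1 - b) * h = s * (y - x l) * h.
  rewrite mulrBl mul1r -[h in h - _]gh -{1}syg -mulrA gh.
  by rewrite bE -(mulrA _ g) gh; non_commutative_ring.
have Jh : jacobson (h - c * s * (y - x l) * h).
  have -> : h - c * s * (y - x l) * h = h - c * (s * (y - x l) * h) by rewrite !mulrA.
  rewrite -Eh mulrA -Ec mulrBl mul1r subKr /h mulrBr bng e0E mulrA bng.
  by rewrite -{1}[b ^+ n.+1]mulr1 -mulrBr.
exists (y - x l), (c * s); split; last first.
  have -> : z - c * s * (y - x l) * z = (z - h * z)
      + ((h - c * s * (y - x l) * h) * z - c * s * (y - x l) * (z - h * z)).
    by non_commutative_ring.
  apply: jacobsonD => //; apply: jacobsonB; first exact: jacobsonMr.
  exact: jacobsonMl.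
have := summable_toB sy (summable_to_single l (x l)); apply: eq_summable_to => i.
rewrite /restrict /= negb_or; case: eqP => [->|_]; first by rewrite nAl subrr.
by rewrite subr0.
Qed.

Definition step_ok l e := [/\ exists s, e l = s * x l, e l * e l = e l,
  forall i, lt i l -> jacobson (e i * e l)
  & exhausts e (fun i => (i == l) || lt i l)].

Lemma eq_exhausts e e' A : (forall i, A i -> e i = e' i) -> exhausts e A -> exhausts e' A.
Proof. by move=> ee' exA z Jz; apply: exA => i Ai; rewrite ee' //; apply: Jz. Qed.

(** [step_ok l] sees [e] only at indices up to [l]; this allows the choice to be made by
    well-founded recursion. *)
Lemma step_ok_local l e e' : e l = e' l -> (forall i, lt i l -> e i = e' i) ->
  step_ok l e -> step_ok l e'.
Proof.
move=> el ei [ex ee etri exh]; rewrite el in ex ee etri; split=> //.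
  by move=> i il; rewrite -ei //; apply: etri.
by apply: eq_exhausts exh => i /orP[/eqP->|/ei].
Qed.

Lemma exists_max_In i F : exists2 m, List.In m (i :: F) &
  forall k, List.In k (i :: F) -> (k == m) || lt k m.
Proof.
elim: F i => [|j F IH] i; first by exists i => [|k []] //; [left|move=> ->; rewrite eqxx].
have [m mF Hm] := IH j.
have [->|/lt_total[im|mi]] := i =P m.
- by exists m => [|k [->|/Hm]] //; [left|rewrite eqxx].
- by exists m => [|k [<-|/Hm]] //; [right|rewrite im orbT].
exists i => [|k [->|/Hm/orP[/eqP->|km]]]; first by left.
- by rewrite eqxx.
- by rewrite mi orbT.
by rewrite (lt_trans km mi) orbT.
Qed.

(** A finite nonempty part of a lower set [A] lies in the initial segment ending at its maximum,
    which is already exhausted; so [exhausts_directed] applies. Zero, successor and limit stages are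
    treated alike. *)
Lemma step_ok_lower e A : (forall i k, A k -> lt i k -> A i) ->
  (forall l, A l -> step_ok l e) -> triangular e A /\ exhausts e A.
Proof.
move=> lowA ok; have tri : triangular e A.
  by split=> [i /ok[]|i /ok[]|i k _ /ok[_ _ h _]] // ik; apply: h.
split=> //; apply: exhausts_directed tri _ => -[_|i F FA].
  exists pred0; split=> // z _; exists 1, 1; split.
    by apply: eq_summable_to sum_x.
  by rewrite !mul1r subrr; apply: jacobson0.
have [m /FA Am Hm] := exists_max_In i F; exists (fun i => (i == m) || lt i m); split=> //.
  by move=> k /orP[/eqP->|/(lowA _ _ Am)].
by have [] := ok _ Am.
Qed.

Lemma wf_choice (P : I -> (I -> R) -> Prop) :
  (forall l e e', e l = e' l -> (forall i, lt i l -> e i = e' i) -> P l e -> P l e') ->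
  (forall l e, (forall i, lt i l -> P i e) ->
     exists r, P l (fun i => if i == l then r else e i)) ->
  exists e, forall l, P l e.
Proof.
move=> local step.
pose ext l (f : forall i, lt i l -> R) (r : R) i :=
  if i == l then r else if pselect (lt i l) is left h then f i h else 0.
(* The choice is total on histories, good or bad, with default 0 when no value works; that the
   actual history is good is proved afterwards by induction. *)
have /choice[c cP] : forall lf : {l : I & forall i, lt i l -> R}, exists r,
    (exists r', P (projT1 lf) (ext _ (projT2 lf) r')) -> P (projT1 lf) (ext _ (projT2 lf) r).
  move=> lf; have [[r Pr]|nr] := pselect (exists r, P (projT1 lf) (ext _ (projT2 lf) r)).
    by exists r.
  by exists 0.
pose E := Fix lt_wf (fun=> R) (fun l f => c (existT _ l f)).
have EE l : E l = c (existT _ l (fun i _ => E i)).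
  rewrite /E Fix_eq // => l' f g fg; congr (c (existT _ l' _)).
  by apply: functional_extensionality_dep => i; apply: functional_extensionality_dep => h.
exists E; elim/(well_founded_ind lt_wf) => l IH.
have [r Pr] := step l E IH.
have /= := cP (existT _ l (fun i _ => E i)); rewrite -EE => H.
have extE r' : (ext l (fun i _ => E i) r' l = r') *
    (forall i, lt i l -> ext l (fun i _ => E i) r' i = E i).
  by rewrite /ext eqxx; split=> // i il; rewrite lt_neq //; case: pselect.
apply: (local _ _ _ _ _ (H _)) => [|i il|]; rewrite ?extE //.
by exists r; apply: (local _ _ _ _ _ Pr) => [|i il]; rewrite ?extE ?eqxx ?lt_neq.
Qed.

Lemma triangular_exists : exists e, triangular e predT /\ exhausts e predT.
Proof.
suff [e He] : exists e, forall l, step_ok l e by exists e; apply: step_ok_lower.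
apply: wf_choice => [|l e ok]; first exact: step_ok_local.
have [] := @step_ok_lower e (fun i => lt i l) => // [i k kl ik|tri exh].
  exact: lt_trans ik kl.
have [|r [rx rr er exr]] := exhausts_step (l := l) tri exh.
  by apply/negP => /lt_neq; rewrite eqxx.
exists r; split; rewrite ?eqxx //; first by move=> i il; rewrite lt_neq //; apply: er.
by apply: exr => [i il|]; rewrite ?eqxx ?lt_neq.
Qed.

(** Nothing remains to sum, so [y = 0]; this puts the idempotent [g] in J, hence [g = 0] and
    [q * phi = 1]. Dedekind-finiteness makes [phi] a unit. *)
Lemma triangular_unit e : triangular e predT -> exhausts e predT ->
  exists phi psi, [/\ summable_to U e phi, psi * phi = 1, phi * psi = 1
  & forall i j, jacobson (e i * psi * e j - (if i == j then e j else 0))].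
Proof.
move=> tri exh; have [phi sphi] := triangular_summable tri.
have [g [q [gg gE Jg]]] := triangular_kernel tri sphi.
have [y [s [sy Jy]]] := exh g Jg.
have y0 : y = 0.
  by apply: nbhs_separated => V UV; apply: summable_to_mem sy _ _ => // i; apply: nbhs0.
have g0 : g = 0.
  by apply: idempotent_jacobson => //; move: Jy; rewrite y0 mulr0 mul0r subr0.
have qphi : q * phi = 1 by rewrite -gE g0 subr0.
have phiq := dfR qphi.
exists phi, q; split=> //.
move=> i j; rewrite -mulrA; set a := q * e j.
have phia : phi * a = e j by rewrite mulrA phiq mul1r.
have [_ ee etri] := tri.
elim/(well_founded_ind lt_wf): i => i IH.
(* Since [phi * a = e j], the elements [e i * D k] sum over [k] to 0. Modulo J those with [k < i]
   vanish by induction and those with [k > i] by triangularity, leaving [e i * D i = D i]. *)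
pose D k := e k * a - (if k == j then e j else 0).
have : jacobson (e i * phi * a - e i * e j - D i).
  have sw := summable_toB (summable_toB (summable_toMr a (summable_toMl (e i) sphi))
    (summable_to_single j (e i * e j))) (summable_to_single i (D i)).
  apply: summable_to_jacobson sw _ => k; rewrite /restrict /=.
  have -> : e i * e k * a - (if k == j then e i * e j else 0) = e i * D k.
    by rewrite mulrBr mulrA; case: eqP; rewrite ?mulr0.
  case: eqP => [->|/lt_total[ki|ik]].
  - suff -> : e i * D i = D i by rewrite subrr; apply: jacobson0.
    by rewrite /D mulrBr mulrA ee //; case: eqP => [->|_]; rewrite ?ee ?mulr0.
  - by rewrite subr0; apply: jacobsonMl; apply: IH.
  rewrite subr0 /D mulrBr mulrA; apply: jacobsonB; first by apply: jacobsonMr; apply: etri.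
  by case: eqP => [<-|_]; rewrite ?mulr0; [apply: etri|apply: jacobson0].
by rewrite -mulrA phia subrr sub0r => /jacobsonN; rewrite opprK.
Qed.

End Transfinite.

(** * From orthogonality modulo J to orthogonality *)

Section Nakayama.
Context {I : eqType} (V : R -> Prop) (UV : U V) (p : I -> R).
Implicit Types (F : seq I) (i k : I).

(* The left ideal [V + sum_(k <- F) J * p k]. *)
Fixpoint jspan F (z : R) : Prop :=
  if F is k :: F' then exists c, jacobson c /\ jspan F' (z - c * p k) else V z.

Lemma jspan_nbhs F z : V z -> jspan F z.
Proof.
elim: F z => //= k F IH z Vz; exists 0; split; first exact: jacobson0.
by rewrite mul0r subr0; apply: IH.
Qed.

Lemma jspanD F a b : jspan F a -> jspan F b -> jspan F (a + b).
Proof.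
elim: F a b => /= [|k F IH] a b; first exact: nbhsD.
move=> [c [Jc ca]] [d [Jd db]]; exists (c + d); split; first exact: jacobsonD.
by rewrite mulrDl opprD addrACA; apply: IH.
Qed.

Lemma jspanMl F r a : jspan F a -> jspan F (r * a).
Proof.
elim: F a => /= [|k F IH] a; first exact: nbhsMl.
move=> [c [Jc ca]]; exists (r * c); split; first exact: jacobsonMl.
by rewrite -mulrA -mulrBr; apply: IH.
Qed.

Lemma jspan_gen F k c : List.In k F -> jacobson c -> jspan F (c * p k).
Proof.
elim: F => //= i F IH [->|kF] Jc.
  by exists c; split=> //; rewrite subrr; apply: jspan_nbhs; apply: nbhs0.
exists 0; split; first exact: jacobson0.
by rewrite mul0r subr0; apply: IH.
Qed.

(** The relation for the head puts [(1 - c) * p a] in the span of the tail, with [1 - c] left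
    invertible. So the head is redundant, and generators are removed one at a time until only [V]
    remains. *)
Lemma nakayama F : (forall k, List.In k F -> jspan F (p k)) ->
  forall k, List.In k F -> V (p k).
Proof.
elim: F => //= a F IH gen.
have Fa : jspan F (p a).
  have [c [/jacobson_left_inverse[u Hu] Fc]] := gen a (or_introl erefl).
  by rewrite -[p a]mul1r -Hu -mulrA mulrBl mul1r; apply: jspanMl.
have sub z : jspan (a :: F) z -> jspan F z.
  move=> [c [_ Fc]]; rewrite -[z](subrK (c * p a)); apply: jspanD => //.
  exact: jspanMl.
have VF : forall k, List.In k F -> V (p k).
  by apply: IH => k kF; apply: sub; apply: gen; right.
suff collapse z : jspan F z -> V z by move=> k [<-|/VF] //; apply: collapse.
elim: F VF z {IH gen Fa sub} => //= k F IH VF z [c [_ Fc]].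
rewrite -[z](subrK (c * p k)); apply: nbhsD => //.
  by apply: IH => // i iF; apply: VF; right.
by apply: nbhsMl => //; apply: VF; left.
Qed.

End Nakayama.

Lemma orthogonal_of_mod_jacobson (I : eqType) (e : I -> R) phi psi :
  (forall i, e i * e i = e i) -> summable_to U e phi -> phi * psi = 1 ->
  (forall i j, jacobson (e i * psi * e j - (if i == j then e j else 0))) ->
  forall i j, e i * psi * e j = if i == j then e j else 0.
Proof.
move=> ee sphi phipsi Jd i0 j.
pose p k := e k * psi * e j - (if k == j then e j else 0).
have ep k : e k * p k = p k.
  by rewrite /p mulrBr !mulrA ee; case: eqP => [->|]; rewrite ?ee ?mulr0.
have sp : summable_to U p 0.
  have := summable_toB (summable_toMr (psi * e j) sphi) (summable_to_single j (e j)).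
  rewrite mulrA phipsi mul1r subrr; apply: eq_summable_to => k.
  by rewrite /p mulrA.
suff p0 : p i0 = 0 by apply/eqP; rewrite -subr_eq0; apply/eqP.
apply: nbhs_separated => V UV.
have [F pF] := summable_to_cauchy sp UV.
have [iF|] := pselect (List.In i0 F); last exact: pF.
apply: (nakayama UV (F := F)) => // i _.
(* As [p k = e k * p k], each [w k] is a defect in J times [p k], while the sum of [w] is [- p i].
   Only the [k] in [F] matter modulo [V], so [p i] lies in [jspan F]. *)
pose w k := e i * psi * p k - (if k == i then p i else 0).
have sw : summable_to U w (- p i).
  have := summable_toB (summable_toMl (e i * psi) sp) (summable_to_single i (p i)).
  by rewrite mulr0 sub0r.
have [F' [ndF' /(_ F' ndF' (fun _ h => h)) HF']] := sw V UV.
have -> : p i = (-1) * (\sum_(k <- F') w k) + (\sum_(k <- F') w k - - p i).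
  by rewrite mulN1r opprK addKr.
apply: (jspanD UV); last exact: jspan_nbhs.
apply: (jspanMl UV); elim: F' {ndF' HF'} => [|k F' IH].
  by rewrite big_nil; apply: jspan_nbhs; apply: nbhs0.
rewrite big_cons; apply: (jspanD UV) => //.
have -> : w k = (e i * psi * e k - (if i == k then e k else 0)) * p k.
  rewrite mulrBl -[_ * e k * p k]mulrA ep /w; congr (_ - _).
  by rewrite eq_sym; case: eqP => [->|_]; rewrite ?ep ?mul0r.
have [kF|/pF Vp] := pselect (List.In k F); first exact: jspan_gen.
by apply: jspan_nbhs; apply: nbhsMl.
Qed.

End FullExchange.

(** * Well-ordering the index set, and the conclusion *)

Lemma well_order_exists (I : eqType) : exists lt : rel I,
  [/\ well_founded lt, transitive lt & forall i j, i <> j -> lt i j \/ lt j i].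
Proof.
have [le wo] := well_ordering_principle I.
have ch : wo_chain le predT := withinW wo.
have tot : total le by move=> i j; apply: (wo_chainW ch).
have anti : antisymmetric le by move=> i j; apply: (wo_chain_antisymmetric ch).
exists (fun i j => ~~ le j i); split.
- move=> i; apply: contrapT => nAcc.
  have [|m [[/asboolP mA mmin] _]] := wo (fun i => `[< ~ Acc (fun i j => ~~ le j i) i >]).
    by exists i; apply/asboolP.
  apply: mA; split=> k km; apply: contrapT => nk.
  by move: km; rewrite mmin //; apply/asboolP.
- move=> j i k ij jk; apply/negP => ki.
  (* Transitivity is read off from the least of the three elements: each candidate contradicts the
     assumed strict inequalities. *)
  have [|m [[mA mmin] _]] := wo (mem [:: i; j; k]); first by exists i; rewrite mem_head.
  have [mi mj mk] : [/\ le m i, le m j & le m k].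
    by split; apply: mmin; rewrite !inE eqxx ?orbT.
  move: mA; rewrite !inE => /or3P[] /eqP Em; rewrite Em in mi mj mk.
  + have E : i = k by apply: anti; rewrite mk ki.
    by move: (tot i j); rewrite {1}E (negPf jk) (negPf ij).
  + by rewrite mi in ij.
  + by rewrite mj in jk.
move=> i j ij; have [ji|] := boolP (le j i); last by left.
by right; apply/negP => lij; apply: ij; apply: anti; rewrite lij ji.
Qed.

Theorem theorem4 (R : pzRingType) (U : (R -> Prop) -> Prop) :
  nice_topology U -> C2_right R -> dedekind_finite R -> semi_pi_regular R ->
  full_exchange U.
Proof.
move=> niceU c2R dfR spR I0 x0.
pose I : eqType := {classic I0}; rewrite -[I0]/(I : Type) in x0 *; move: x0 => x sx.
have [lt [lt_wf lt_tr lt_tot]] := well_order_exists I.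
have [e [tri exh]] := triangular_exists dfR spR c2R niceU lt_wf lt_tr lt_tot sx.
have [phi [psi [sphi psiphi phipsi Jd]]] :=
  triangular_unit dfR spR c2R niceU lt_wf lt_tot sx tri exh.
have [ex ee _] := tri.
have orth := orthogonal_of_mod_jacobson dfR niceU (fun i => ee i isT) sphi phipsi Jd.
exists (fun i => psi * e i); split.
  by move=> i; rewrite mulrA -[psi * e i * psi]mulrA -mulrA orth eqxx.
split.
  move=> i j ij; rewrite mulrA -[psi * e i * psi]mulrA -mulrA orth.
  by case: eqP => // _; rewrite mulr0.
split; last by rewrite -psiphi; apply: summable_toMl.
by move=> i; have [s ->] := ex i isT; exists (psi * s); rewrite mulrA.
Qed.
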